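(* Fix a nonempty closed interval $I_\Lambda\subseteq[\Lambda_{\min},\Lambda_{\max}]$ with $0<\Lambda_{\min}\le\Lambda_{\max}$, and a set $\mathcal{P}=\{q\in\Delta_m:\ \|q-\hat p\|_1\le\varepsilon\}$ for some $\hat p\in\Delta_m$ and $\varepsilon\ge 0$, where $\Delta_m$ is the set of probability vectors on $\{1,\dots,m\}$. Let $\mathcal{C}$ be the set of admission-control CTMDPs $\mathcal{M}_{\Lambda,p(\cdot)}$ with $\Lambda\in I_\Lambda$ and $p(s)\in\mathcal{P}$ for every $s\in\{0,\dots,S\}$. Let $\widetilde{\mathcal{M}}=\mathcal{M}_{\tilde\Lambda,\tilde p(\cdot)}$, where $\tilde\Lambda=\max I_\Lambda$ and, for each state $s$, $\tilde p(s)$ is the lexicographic maximizer over $\mathcal{P}$ of the vector $(q^{(\sigma_s(1))},q^{(\sigma_s(2))},\dots,q^{(\sigma_s(m))})$, with $\sigma_s$ an ordering of the classes by non-increasing $r^{(i)}(s)$ (i.e. $\tilde p(s)$ first maximizes the probability of the highest-priority class in state $s$, then, subject to that, of the second, etc.). Then $\widetilde{\mathcal{M}}\in\mathcal{C}$ and its optimal long-run average reward is at least the optimal long-run average reward of every CTMDP in $\mathcal{C}$.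
   Context: Admission control to an $M/M/c/S$ queue: states $s\in\{0,1,\dots,S\}$ = number of jobs in the system; $c\ge1$ identical servers each of rate $\mu>0$, total service rate $\mu(s)=\min(s,c)\mu$ in state $s$. There are $m$ job classes; each class $i$ has a known expected reward $r^{(i)}(s)\in\mathbb{R}$ for admitting it in state $s$. For $\Lambda>0$ and probability vectors $p(s)=(p^{(1)}(s),\dots,p^{(m)}(s))$, the CTMDP $\mathcal{M}_{\Lambda,p(\cdot)}$ is the one where, in state $s$, class-$i$ jobs arrive as a Poisson stream of rate $\lambda^{(i)}(s)=\Lambda p^{(i)}(s)$; an action in state $s<S$ is a subset $a\subseteq\{1,\dots,m\}$ of classes to admit (in state $S$ nothing is admitted); under action $a$ the birth rate is $\sum_{i\in a}\lambda^{(i)}(s)$, the death rate is $\mu(s)$, and the reward rate is $\sum_{i\in a}\lambda^{(i)}(s)r^{(i)}(s)$. The long-run average reward of a stationary policy $\pi$ is $\rho^\pi=\lim_{T\to\infty}\frac1T\mathbb{E}\int_0^T R^\pi(s_t)\,dt$ with $R^\pi(s)$ the reward rate of the chosen action in state $s$; the optimal average reward is the supremum over stationary (possibly randomized) policies. *)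

(* Defs.v *)
From HB Require Import structures.
From mathcomp Require Import all_boot all_order all_algebra all_fingroup.
From mathcomp Require Import all_classical all_reals all_analysis.
Set Implicit Arguments. Unset Strict Implicit. Unset Printing Implicit Defensive.
Import Order.TTheory GRing.Theory Num.Theory.
Import numFieldNormedType.Exports.
Local Open Scope classical_set_scope.
Local Open Scope ring_scope.

Section AdmissionControl.
Variables (R : realType) (S c m : nat) (mu : R) (r : 'I_m -> 'I_S.+1 -> R).

Definition is_prob (q : 'I_m -> R) : Prop :=
  (forall i, 0 <= q i) /\ \sum_(i < m) q i = 1.

Definition in_ball (phat : 'I_m -> R) (eps : R) (q : 'I_m -> R) : Prop :=
  is_prob q /\ \sum_(i < m) `|q i - phat i| <= eps.

(* stationary randomized policy: in each state a probability distribution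
   over actions = subsets of classes to admit *)
Definition policy := 'I_S.+1 -> {set 'I_m} -> R.
Definition is_policy (pi : policy) : Prop :=
  forall s, (forall a, 0 <= pi s a) /\ \sum_(a : {set 'I_m}) pi s a = 1.

Definition lam (Lam : R) (p : 'I_S.+1 -> 'I_m -> R) (s : 'I_S.+1) (i : 'I_m) : R :=
  Lam * p s i.

Definition birth Lam p (pi : policy) (s : 'I_S.+1) : R :=
  if (s < S)%N then \sum_(a : {set 'I_m}) pi s a * \sum_(i in a) lam Lam p s i
  else 0.

Definition reward_rate Lam p (pi : policy) (s : 'I_S.+1) : R :=
  if (s < S)%N then
    \sum_(a : {set 'I_m}) pi s a * \sum_(i in a) lam Lam p s i * r i s
  else 0.

Definition death (s : 'I_S.+1) : R := (minn s c)%:R * mu.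

Definition generator Lam p (pi : policy) : 'M[R]_(S.+1) :=
  \matrix_(i, j)
    (if (j : nat) == i.+1 then birth Lam p pi i
     else if (j.+1 == i)%N then death i
     else if i == j then - (birth Lam p pi i + death i)
     else 0).

(* transition probabilities P_t = exp(t Q), entrywise power series *)
Definition trans Lam p (pi : policy) (t : R) (i j : 'I_S.+1) : R :=
  lim (series (fun k : nat => ((t *: generator Lam p pi) ^+ k) i j / (k`!)%:R) @ \oo).

Definition exp_reward Lam p (pi : policy) (s0 : 'I_S.+1) (t : R) : R :=
  \sum_(j < S.+1) trans Lam p pi t s0 j * reward_rate Lam p pi j.

Definition avg_reward Lam p (pi : policy) (s0 : 'I_S.+1) : R :=
  lim ((fun T : R => T^-1 * Rintegral lebesgue_measure `[0, T] (exp_reward Lam p pi s0))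
         @ +oo).

Definition opt_reward Lam p (s0 : 'I_S.+1) : R :=
  sup [set avg_reward Lam p pi s0 | pi in is_policy].

Definition in_class (a b : R) (phat : 'I_m -> R) (eps : R) (Lam : R) (p : 'I_S.+1 -> 'I_m -> R) : Prop :=
  a <= Lam <= b /\ forall s, in_ball phat eps (p s).

End AdmissionControl.

Definition lex_ge (R : realType) (m : nat) (u v : 'I_m -> R) : Prop :=
  u = v \/ exists k : 'I_m, (forall j : 'I_m, (j < k)%N -> u j = v j) /\ v k < u k.

Definition priority_order (R : realType) (S m : nat) (r : 'I_m -> 'I_S.+1 -> R)
  (s : 'I_S.+1) (sigma : {perm 'I_m}) : Prop :=
  forall k l : 'I_m, (k <= l)%N -> r (sigma l) s <= r (sigma k) s.

Definition lex_maximizer (R : realType) (m : nat) (Q : ('I_m -> R) -> Prop)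
  (sigma : {perm 'I_m}) (q : 'I_m -> R) : Prop :=
  Q q /\ forall q', Q q' -> lex_ge (fun k => q (sigma k)) (fun k => q' (sigma k)).

(* Main.v *)
(** Fix a policy of a CTMDP in the class and consider the birth rates it
induces.  In each state, the partial sums along the priority order of any
probability vector of the ball are at most [min 1 (Phat k + eps / 2)], and the
lexicographic maximizer attains all these bounds.  Hence a randomized threshold
policy of the optimistic model, mixing two consecutive sets of top-priority
classes, realizes the same birth rate in every state, and Abel summation along
the priority order shows that its reward rates are at least as large.  Both
policies then have the same generator [Q].

The average reward is monotone in the reward rates [f] for a fixed [Q]: the
Poisson equation [f = rho + Q h] of a birth-death chain is solvable, and
[e^{tQ} f = rho + d/dt (e^{tQ} h)] with [e^{tQ}] bounded (it is stochastic, by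
uniformization), so the average reward is [rho]; the maximum principle for [Q]
gives the monotonicity of [rho] in [f]. *)

Require Import Defs.
From HB Require Import structures.
From mathcomp Require Import all_boot all_order all_algebra all_fingroup.
From mathcomp Require Import all_classical all_reals all_analysis.
From mathcomp Require Import ring lra zify.

Set Implicit Arguments. Unset Strict Implicit. Unset Printing Implicit Defensive.
Import Order.TTheory GRing.Theory Num.Theory.
Import numFieldNormedType.Exports.
Local Open Scope classical_set_scope.
Local Open Scope ring_scope.

(** * Matrix exponential *)

Section matrix_exponential.
Context {R : realType}.

(** Comparison with [C] times the exponential series at [M * |x|]. *)
Lemma is_cvg_pseries_factorial_bound (c : R^nat) (C M x : R) :
  0 <= M -> (forall k, `|c k| <= C * M ^+ k / k`!%:R) -> cvgn (pseries c x).
Proof.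
move=> M0 cM.
have C0 : 0 <= C by have := cM 0%N; rewrite expr0 mulr1 divr1; exact: le_trans.
apply: normed_cvg; apply: (@series_le_cvg _ _ (fun k => C * exp_coeff (M * `|x|) k)).
- by move=> n; exact: normr_ge0.
- by move=> n; rewrite /exp_coeff /= mulr_ge0// divr_ge0// exprn_ge0// mulr_ge0.
- move=> n; rewrite /exp_coeff /= normrM normrX exprMn.
  apply: le_trans (ler_wpM2r _ (cM n)) _; first exact: exprn_ge0.
  by rewrite [leRHS]mulrA (mulrA C) mulrAC.
- exact: (is_cvg_seriesZ (is_cvg_series_exp_coeff (M * `|x|))).
Qed.

Lemma lim_pseries_sum (I : finType) (c : I -> R^nat) (w : I -> R) (x : R) :
  (forall i, cvgn (pseries (c i) x)) ->
  limn (pseries (fun k => \sum_i w i * c i k) x) =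
  \sum_i w i * limn (pseries (c i) x).
Proof.
move=> cc; apply: cvg_lim => //.
rewrite (_ : pseries _ x =
    (fun n => \sum_i w i * pseries (c i) x n)); last first.
  apply/funext => n; rewrite /pseries /series/=.
  under [RHS]eq_bigr do rewrite mulr_sumr.
  rewrite exchange_big/=; apply: eq_bigr => k _.
  by rewrite mulr_suml; apply: eq_bigr => i _; rewrite mulrA.
apply: cvg_big => [|i _]; [exact: add_continuous|apply: cvgMl_tmp; exact: cc].
Qed.

Context {n : nat}.
Implicit Types (A : 'M[R]_n.+1).

Definition expmx_coef A (i j : 'I_n.+1) (k : nat) : R := (A ^+ k) i j / k`!%:R.

Definition expmx A (t : R) : 'M[R]_n.+1 :=
  \matrix_(i, j) limn (pseries (expmx_coef A i j) t).

Lemma norm_exprmx_le A (k : nat) i j :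
  `|(A ^+ k) i j| <= (\sum_i \sum_j `|A i j|) ^+ k.
Proof.
elim: k i j => [|k IH] i j.
  by rewrite !expr0 mxE; case: (i == j); rewrite ?normr1 ?normr0.
rewrite !exprSr mxE; apply: le_trans (ler_norm_sum _ _ _) _.
rewrite mulr_sumr ler_sum// => l _; rewrite normrM ler_pM//.
by rewrite (bigD1 j)//= lerDl sumr_ge0.
Qed.

(** Each formal derivative of the exponential series raises the power of [A] by one, hence the shift
    [d]; termwise differentiation uses [d] equal to 0, 1 and 2. *)
Lemma is_cvg_expmx_shift A i j (d : nat) (t : R) :
  cvgn (pseries (fun k => (A ^+ (k + d)) i j / k`!%:R) t).
Proof.
pose M := \sum_i \sum_j `|A i j|.
apply: (@is_cvg_pseries_factorial_bound _ (M ^+ d) M).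
  by apply: sumr_ge0 => ? _; apply: sumr_ge0.
move=> k; rewrite normrM [X in _ * X]ger0_norm ?invr_ge0// ler_wpM2r ?invr_ge0//.
by rewrite -exprD addnC; exact: norm_exprmx_le.
Qed.

Lemma is_cvg_expmx A i j (t : R) : cvgn (pseries (expmx_coef A i j) t).
Proof.
have := @is_cvg_expmx_shift A i j 0 t.
by under [X in pseries X]funext do rewrite addn0.
Qed.

Lemma pseries_diffs_expmx_shift A i j (d : nat) :
  pseries_diffs (fun k => (A ^+ (k + d)) i j / k`!%:R) =
  (fun k => (A ^+ (k + d.+1)) i j / k`!%:R).
Proof.
apply/funext => k; rewrite /pseries_diffs addSnnS factS natrM invfM.
by rewrite [X in _ * X]mulrCA mulVKf.
Qed.

Lemma is_derive_expmx A (t : R) i j :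
  is_derive t (1 : R) (fun t => expmx A t i j) ((expmx A t *m A) i j).
Proof.
have E0 : expmx_coef A i j = (fun k => (A ^+ (k + 0)) i j / k`!%:R).
  by apply/funext => k; rewrite addn0.
have -> : (fun t => expmx A t i j) =
          (fun t => limn (pseries (expmx_coef A i j) t)).
  by apply/funext => u; rewrite mxE.
have -> : (expmx A t *m A) i j =
          limn (pseries (pseries_diffs (expmx_coef A i j)) t).
  rewrite E0 pseries_diffs_expmx_shift.
  have -> : (fun k => (A ^+ (k + 1)) i j / k`!%:R) =
            (fun k => \sum_l A l j * expmx_coef A i l k).
    apply/funext => k; rewrite addn1 exprSr mxE mulr_suml.
    by apply: eq_bigr => l _; rewrite mulrCA mulrA.
  rewrite lim_pseries_sum; last by move=> l; exact: is_cvg_expmx.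
  by rewrite mxE; apply: eq_bigr => l _; rewrite mxE mulrC.
(* Termwise differentiation at [t] needs convergence at a point of larger modulus. *)
apply: (@pseries_snd_diffs _ _ (`|t| + 1)); rewrite ?E0 ?pseries_diffs_expmx_shift;
  try exact: is_cvg_expmx_shift.
by rewrite [ltRHS]ger0_norm ?ltrDl// addr_ge0.
Qed.

Lemma expmx_comm A (t : R) : A *m expmx A t = expmx A t *m A.
Proof.
apply/matrixP => i j; rewrite !mxE.
under eq_bigr do rewrite mxE.
under [RHS]eq_bigr do rewrite mxE mulrC.
rewrite -!lim_pseries_sum; try by move=> *; exact: is_cvg_expmx.
congr (limn (pseries _ t)); apply/funext => k; rewrite /expmx_coef.
under eq_bigr do rewrite mulrA.
under [RHS]eq_bigr do rewrite mulrA [A _ _ * _]mulrC.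
rewrite -!mulr_suml; congr (_ / _).
by have /matrixP/(_ i j) := exprS A k; rewrite exprSr !mxE.
Qed.

Lemma expmx0 A : expmx A 0 = 1%:M.
Proof.
apply/matrixP => i j; rewrite mxE.
apply: lim_near_cst => //.
near=> k; have -> : k = k.-1.+1 by rewrite prednK//; near: k; exact: nbhs_infty_gt.
rewrite /pseries /series/= big_nat_recl//= big1 ?addr0.
  by rewrite /expmx_coef !expr0 fact0 divr1 mulr1.
by move=> l _; rewrite exprS mul0r mulr0.
Unshelve. all: by end_near. Qed.

Lemma expmx_ge0_pos A (t : R) : (forall i j, 0 <= A i j) -> 0 <= t ->
  forall i j, 0 <= expmx A t i j.
Proof.
move=> A0 t0 i j; rewrite mxE; apply: limr_ge; first exact: is_cvg_expmx.
have Ak k : forall i j, 0 <= (A ^+ k) i j.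
  elim: k => [|k IH] i' j'; first by rewrite expr0 mxE ler0n.
  by rewrite exprSr mxE sumr_ge0// => l _; rewrite mulr_ge0.
near=> k; rewrite /pseries /series/= sumr_ge0// => l _.
by rewrite mulr_ge0 ?exprn_ge0// divr_ge0.
Unshelve. all: by end_near. Qed.

(* [s |-> expmx A (t - s) *m Y s] has derivative [0]. *)
Lemma expmx_ode_unique A (Y : R -> 'M[R]_n.+1) :
  (forall s i j, is_derive s (1 : R) (fun s => Y s i j) ((A *m Y s) i j)) ->
  forall t, Y t = expmx A t *m Y 0.
Proof.
move=> dY t; apply/matrixP => i j.
pose G s := (expmx A (t - s) *m Y s) i j.
suff : G t = G 0 by rewrite /G subrr subr0 expmx0 mul1mx.
apply: is_derive_0_is_cst => s.
have -> : G = \sum_(l < n.+1)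
    ((fun s => expmx A (t - s) i l) * (fun s => Y s l j)).
  by apply/funext => u; rewrite /G mxE fct_sumE.
have dtB : is_derive s (1 : R) (fun s => t - s) (-1).
  by rewrite -[X in is_derive _ _ _ X]sub0r; exact: is_deriveB.
have dP l : is_derive s (1 : R) (fun s => expmx A (t - s) i l)
    (- (expmx A (t - s) *m A) i l).
  rewrite -mulrN1.
  exact: (@is_derive1_comp _ (fun u => expmx A u i l) (fun s => t - s)
            s _ _ (is_derive_expmx _ _ _ _) dtB).
have dG := is_derive_sum (fun l => is_deriveM (dP l) (dY s l j)).
apply: is_derive_eq dG _.
have E : \sum_l expmx A (t - s) i l * (A *m Y s) l j =
         \sum_l (expmx A (t - s) *m A) i l * Y s l j.
  by have /matrixP/(_ i j) := mulmxA (expmx A (t - s)) A (Y s);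
    rewrite [LHS]mxE [RHS]mxE.
rewrite big_split/= [X in X + _]E -big_split/= big1// => l _.
by rewrite /GRing.scale/= mulrN mulrC subrr.
Qed.

(** Both sides solve [Y' = A Y] with [Y 0 = 1]; uniqueness of the solution replaces a Cauchy product
    of commuting exponentials. *)
Lemma expmx_add_scalar A (c t : R) :
  expR (- c * t) *: expmx (A + c%:M) t = expmx A t.
Proof.
suff dY s i j : is_derive s (1 : R)
    (fun s => (expR (- c * s) *: expmx (A + c%:M) s) i j)
    ((A *m (expR (- c * s) *: expmx (A + c%:M) s)) i j).
  by rewrite (expmx_ode_unique dY) mulr0 expR0 scale1r expmx0 mulmx1.
have -> : (fun s => (expR (- c * s) *: expmx (A + c%:M) s) i j) =
    (expR \o (fun s => - c * s)) * (fun s => expmx (A + c%:M) s i j).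
  by apply/funext => u; rewrite mxE.
have dc : is_derive s (1 : R) (fun s => - c * s) (- c).
  rewrite -[X in is_derive _ _ _ X]mulr1.
  exact: is_deriveZ.
have dE := is_derive1_comp (is_derive_expR (- c * s)) dc.
have dY := is_deriveM dE (is_derive_expmx (A + c%:M) s i j).
apply: is_derive_eq dY _.
rewrite -expmx_comm mulmxDl mul_scalar_mx -scalemxAr !mxE /GRing.scale/=.
ring.
Qed.

(** Uniformization: adding a large enough multiple of the identity makes all entries nonnegative and
    changes the exponential only by a positive factor. *)
Lemma expmx_ge0 A (t : R) : (forall i j, i != j -> 0 <= A i j) -> 0 <= t ->
  forall i j, 0 <= expmx A t i j.
Proof.
move=> A0 t0 i j.
rewrite -(expmx_add_scalar A (\sum_i `|A i i|)) mxE mulr_ge0 ?expR_ge0//.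
apply: expmx_ge0_pos t0 _ _ => {}i {}j; rewrite !mxE.
have [<-|ij] := eqVneq i j; last by rewrite addr0 A0.
rewrite mulr1n (bigD1 i)//= addrA addr_ge0 ?sumr_ge0//.
by rewrite -lerBlDl sub0r ler_normr lexx orbT.
Qed.

(** The row sums equal 1 at time 0, and their derivative is [expmx A t] applied to the zero row sums
    of [A]. *)
Lemma expmx_row_sum A (t : R) i : (forall i, \sum_j A i j = 0) ->
  \sum_j expmx A t i j = 1.
Proof.
move=> A0; pose F u := \sum_j expmx A u i j.
have <- : F 0 = 1.
  rewrite /F expmx0 (bigD1 i)//= big1 ?addr0 ?mxE ?eqxx// => j ji.
  by rewrite mxE eq_sym (negbTE ji).
apply: (@is_derive_0_is_cst _ F) => s.
have -> : F = \sum_(j < n.+1) (fun u => expmx A u i j).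
  by apply/funext => u; rewrite /F fct_sumE.
apply: is_derive_eq (is_derive_sum (is_derive_expmx A s i)) _.
under eq_bigr do rewrite mxE.
by rewrite exchange_big/= big1// => l _; rewrite -mulr_sumr A0 mulr0.
Qed.

Lemma norm_expmx_le1 A (t : R) : (forall i j, i != j -> 0 <= A i j) ->
  (forall i, \sum_j A i j = 0) -> 0 <= t -> forall i j, `|expmx A t i j| <= 1.
Proof.
move=> A0 As t0 i j; rewrite ger0_norm ?expmx_ge0// -(expmx_row_sum t i As).
by rewrite (bigD1 j)//= lerDl sumr_ge0// => l _; exact: expmx_ge0.
Qed.

End matrix_exponential.

(** * Poisson equation and long-run averages *)

Section poisson_equation.
Context {R : realType} {n : nat}.
Variables (Q : 'M[R]_n.+1).
Hypothesis Q_ge0 : forall i j, i != j -> 0 <= Q i j.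
Hypothesis Q_sum0 : forall i, \sum_j Q i j = 0.
Implicit Types (f h : 'I_n.+1 -> R) (rho : R).

(** In the language of decision processes, [rho] is the gain and [h] the bias of the reward [f]. *)
Definition poisson f rho h := forall i, f i = rho + \sum_j Q i j * h j.

(* Maximum principle: [Q (h2 - h1)] is nonpositive where [h2 - h1] is maximal. *)
Lemma poisson_le f1 rho1 h1 f2 rho2 h2 : poisson f1 rho1 h1 ->
  poisson f2 rho2 h2 -> (forall i, f1 i <= f2 i) -> rho1 <= rho2.
Proof.
move=> P1 P2 f12; pose k i := h2 i - h1 i.
have [i _ imax] := @Order.TotalTheory.arg_maxP _ _ _ ord0 xpredT k erefl.
have : \sum_j Q i j * (k j - k i) <= 0.
  apply: sumr_le0 => j _; have [<-|ij] := eqVneq i j; first by rewrite subrr mulr0.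
  by rewrite mulr_ge0_le0 ?Q_ge0// subr_le0; exact: imax.
under eq_bigr do rewrite mulrBr.
rewrite sumrB -mulr_suml Q_sum0 mul0r subr0 /k.
under eq_bigr do rewrite mulrBr.
rewrite sumrB; have := f12 i; rewrite P1 P2; lra.
Qed.

Lemma poisson_cst rho : poisson (fun=> rho) rho (fun=> 0).
Proof. by move=> i; rewrite big1 ?addr0// => j _; rewrite mulr0. Qed.

Lemma is_derive_expmx_mul h (t : R) i :
  is_derive t (1 : R) (fun t => \sum_j expmx Q t i j * h j)
    (\sum_j expmx Q t i j * \sum_l Q j l * h l).
Proof.
have -> : (fun t => \sum_j expmx Q t i j * h j) =
    \sum_(j < n.+1) (h j \*: (fun t => expmx Q t i j)).
  apply/funext => u; rewrite fct_sumE; apply: eq_bigr => j _.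
  by rewrite mulrC.
have dS := is_derive_sum (fun j => is_deriveZ (h j) (is_derive_expmx Q t i j)).
apply: is_derive_eq dS _.
under [RHS]eq_bigr do rewrite mulr_sumr.
rewrite exchange_big/=; apply: eq_bigr => l _; rewrite mxE scaler_sumr.
by apply: eq_bigr => j _; rewrite /GRing.scale/= mulrC mulrA.
Qed.

Lemma continuous_expmx_mul h i :
  continuous (fun t => \sum_j expmx Q t i j * h j).
Proof.
move=> t; apply: differentiable_continuous; apply/derivable1_diffP.
by have [] := is_derive_expmx_mul h t i.
Qed.

Lemma Rintegral_expmx_poisson f rho h (T : R) i : poisson f rho h -> 0 < T ->
  Rintegral lebesgue_measure `[0, T] (fun t => \sum_j expmx Q t i j * f j) =
  rho * T + (\sum_j expmx Q T i j * h j - h i).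
Proof.
(* [F] is an antiderivative of the integrand: [expmx Q t] fixes constants, so applying it to the
   Poisson equation gives [rho] plus the derivative of [expmx Q t] applied to [h]. *)
move=> P T0; pose F t := rho * t + \sum_j expmx Q t i j * h j.
have dF t : is_derive t (1 : R) F (\sum_j expmx Q t i j * f j).
  have dr := is_deriveZ rho (is_derive_id t (1 : R)).
  have dF := is_deriveD dr (is_derive_expmx_mul h t i).
  apply: is_derive_eq dF _.
  under [RHS]eq_bigr do rewrite P mulrDr.
  rewrite big_split/= -mulr_suml (expmx_row_sum t i Q_sum0) mul1r.
  by rewrite /GRing.scale/= mulr1.
have cF : continuous F.
  move=> t; apply: differentiable_continuous; apply/derivable1_diffP.
  by have [] := dF t.
rewrite /Rintegral (@continuous_FTC2 _ _ F _ _ T0).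
- rewrite -EFinB /= /F mulr0 add0r -addrA; congr (_ + (_ - _)).
  rewrite (bigD1 i)//= big1 ?expmx0 ?addr0 ?mxE ?eqxx ?mul1r// => j ji.
  by rewrite mxE eq_sym (negbTE ji) mul0r.
- by apply: continuous_subspaceT; exact: continuous_expmx_mul.
- split.
  + by move=> x _; have [] := dF x.
  + exact/cvg_at_right_filter/cF.
  + exact/cvg_at_left_filter/cF.
- by move=> x _; rewrite derive1E; have [_ ->] := dF x.
Qed.

Lemma cesaro_expmx_poisson f rho h i : poisson f rho h ->
  (fun T => T^-1 * Rintegral lebesgue_measure `[0, T]
     (fun t => \sum_j expmx Q t i j * f j)) @ +oo --> rho.
Proof.
(* [C] bounds the boundary term of the integral uniformly in [T], because the entries of [expmx Q T]
   are at most 1 in absolute value. *)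
move=> P; pose C := (\sum_j `|h j|) + `|h i|.
have C0 : 0 <= C by rewrite addr_ge0// sumr_ge0.
apply/cvgrPdist_le => e e0; near=> T.
have T0 : 0 < T by near: T; exact: nbhs_pinfty_gt.
rewrite (Rintegral_expmx_poisson _ P T0) mulrDr mulrCA mulVf ?gt_eqF// mulr1.
rewrite opprD addNKr normrN normrM gtr0_norm ?invr_gt0// ler_pdivrMl//.
apply: (@le_trans _ _ C).
  rewrite (le_trans (ler_normB _ _))// lerD2r (le_trans (ler_norm_sum _ _ _))//.
  apply: ler_sum => j _; rewrite normrM ler_piMl//.
  by apply: norm_expmx_le1 => //; exact: ltW.
rewrite -ler_pdivrMr//; near: T; exact: nbhs_pinfty_ge.
Unshelve. all: by end_near. Qed.

End poisson_equation.

(** * Solving the Poisson equation of a birth-death chain *)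

Section birth_death.
Context {R : realType}.
Variables (S : nat) (beta delta : nat -> R).

(** The solution of [delta s * d s.-1 = beta s * d s + g s] with [d S = 0], indexed from the top:
    entry [k] is [d (S - k)]. In the Poisson equation, [d s] stands for [h s.+1 - h s] and [g] for
    [rho - f]. *)
Fixpoint backward_increment (g : nat -> R) (k : nat) : R :=
  if k is k'.+1 then
    (beta (S - k') * backward_increment g k' + g (S - k')%N) / delta (S - k')
  else 0.

Hypothesis beta_ge0 : forall s, 0 <= beta s.
Hypothesis delta_gt0 : forall s, (0 < s <= S)%N -> 0 < delta s.
Hypothesis delta0 : delta 0 = 0.

Lemma backward_increment_ge0 (g : nat -> R) k : (forall s, 0 <= g s) ->
  (k <= S)%N -> 0 <= backward_increment g k.
Proof.
move=> g0; elim: k => //= k IH kS; rewrite divr_ge0// ?addr_ge0 ?mulr_ge0 ?IH//.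
  exact: ltnW.
by apply/ltW/delta_gt0; rewrite subn_gt0 kS leq_subr.
Qed.

(* The increments of [h] are affine in [rho] and determined downwards from
   state [S]; the equation at state [0] then fixes [rho]. *)
Lemma birth_death_poisson (f : nat -> R) : exists rho (h : nat -> R),
  forall s, (s <= S)%N ->
    f s = rho + (beta s * (h s.+1 - h s) - delta s * (h s - h s.-1)).
Proof.
pose A := backward_increment (fun=> 1); pose B := backward_increment (fun s => - f s).
have A0 : 0 <= A S by apply: backward_increment_ge0.
(* This is the coefficient of [rho] in the equation at state 0. *)
have D0 : 1 + beta 0 * A S != 0.
  by rewrite gt_eqF// ltr_pwDl// mulr_ge0.
pose rho := (f 0 - beta 0 * B S) / (1 + beta 0 * A S).
pose d s := rho * A (S - s)%N + B (S - s)%N.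
(* Since [d S = 0], the birth term vanishes at state [S] whatever [beta S] is. *)
exists rho, (fun s => \sum_(0 <= u < s) d u) => s sS.
rewrite big_nat_recr//= addrAC subrr add0r.
case: s sS => [_|s sS].
  rewrite delta0 mul0r subr0 /d subn0 /rho; field.
  exact: D0.
rewrite big_nat_recr//= addrAC subrr add0r.
have ds : delta s.+1 != 0 by rewrite gt_eqF// delta_gt0.
rewrite /d.
have -> : (S - s = (S - s.+1).+1)%N by lia.
have -> : A (S - s.+1).+1 =
    (beta s.+1 * A (S - s.+1)%N + 1) / delta s.+1 by rewrite /A /= subKn.
have -> : B (S - s.+1).+1 =
    (beta s.+1 * B (S - s.+1)%N - f s.+1) / delta s.+1 by rewrite /B /= subKn.
by field.
Qed.

End birth_death.

(** * Lexicographic maximizers and threshold policies *)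

Section partial_sums.
Context {R : realType}.

Lemma psum_full m (q : 'I_m -> R) (k : nat) : (m <= k)%N ->
  \sum_(j < m | (j < k)%N) q j = \sum_j q j.
Proof. by move=> mk; apply: eq_bigl => j; rewrite (leq_trans (ltn_ord j)). Qed.

(* Abel summation. *)
Lemma sumr_mul_nonincreasing_ge n (z w : 'I_n.+1 -> R) :
  (forall k l : 'I_n.+1, (k <= l)%N -> w l <= w k) ->
  (forall k : nat, 0 <= \sum_(j < n.+1 | (j < k)%N) z j) ->
  (\sum_j z j) * w ord_max <= \sum_j z j * w j.
Proof.
elim: n z w => [|n IH] z w ww zz.
  by rewrite !big_ord1 (_ : ord_max = ord0)//; exact/val_inj.
rewrite big_ord_recr [leRHS]big_ord_recr/= mulrDl lerD2r.
pose z' (j : 'I_n.+1) := z (widen_ord (leqnSn n.+1) j).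
pose w' (j : 'I_n.+1) := w (widen_ord (leqnSn n.+1) j).
have zz' k : 0 <= \sum_(j < n.+1 | (j < k)%N) z' j.
  (* Truncating [k] at [n.+1] keeps the last index out of the prefix. *)
  have := zz (minn k n.+1); rewrite big_mkcond big_ord_recr/=.
  rewrite [X in _ + X]ifF ?addr0; last by apply/negbTE; lia.
  move/le_trans; apply; rewrite [leRHS]big_mkcond/=; apply: ler_sum => j _.
  by rewrite leq_min (ltn_ord j) andbT.
apply: le_trans (IH z' w' _ zz') => [|k l kl]; last exact: ww.
apply: ler_wpM2l; last by apply: ww; rewrite /= leqnSn.
by apply: le_trans (zz' n.+1) _; rewrite psum_full.
Qed.

(** Zero total mass removes the boundary term of Abel summation, so [w] may take negative values. *)
Lemma sumr_mul_nonincreasing_ge0 m (z w : 'I_m -> R) :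
  (forall k l : 'I_m, (k <= l)%N -> w l <= w k) ->
  (forall k : nat, 0 <= \sum_(j < m | (j < k)%N) z j) ->
  \sum_j z j = 0 -> 0 <= \sum_j z j * w j.
Proof.
case: m z w => [|m] z w ww zz z0; first by rewrite big_ord0.
by have := sumr_mul_nonincreasing_ge ww zz; rewrite z0 mul0r.
Qed.

Lemma psumS m (q : 'I_m -> R) (k : 'I_m) :
  \sum_(j < m | (j < k.+1)%N) q j = \sum_(j < m | (j < k)%N) q j + q k.
Proof.
rewrite (bigD1 k)//= addrC; congr (_ + _); apply: eq_bigl => j.
by rewrite ltnS (ltn_neqAle j k) andbC.
Qed.

Lemma psum_le_sum m (q : 'I_m -> R) (k : nat) : (forall j, 0 <= q j) ->
  \sum_(j < m | (j < k)%N) q j <= \sum_j q j.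
Proof.
move=> q0; rewrite [leRHS](bigID (fun j : 'I_m => (j < k)%N))/= lerDl.
exact: sumr_ge0.
Qed.

Lemma telescope_psum m (F : nat -> R) (k : nat) : (k <= m)%N ->
  \sum_(j < m | (j < k)%N) (F j.+1 - F j) = F k - F 0%N.
Proof.
move=> km; rewrite -(big_ord_widen m (fun j => F j.+1 - F j) km).
by rewrite -(big_mkord xpredT (fun j => F j.+1 - F j)) telescope_sumr.
Qed.

(** The differences [q j - v j] sum to zero, so a surplus on a prefix is matched by an equal deficit
    on its complement; both count in the distance, hence the half. *)
Lemma in_ball_psum_le m (v q : 'I_m -> R) (eps : R) (k : nat) :
  is_prob v -> in_ball v eps q ->
  \sum_(j < m | (j < k)%N) q j <= \sum_(j < m | (j < k)%N) v j + eps / 2.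
Proof.
move=> [v0 v1] [[q0 q1] qv].
have H : \sum_j (q j - v j) = 0 by rewrite sumrB q1 v1 subrr.
move: H qv; rewrite (bigID (fun j : 'I_m => (j < k)%N))/=.
rewrite [X in X <= eps](bigID (fun j : 'I_m => (j < k)%N))/=.
have : \sum_(j < m | (j < k)%N) (q j - v j)
       <= \sum_(j < m | (j < k)%N) `|q j - v j|.
  by apply: ler_sum => j _; exact: ler_norm.
have : - \sum_(j < m | ~~ (j < k)%N) (q j - v j)
       <= \sum_(j < m | ~~ (j < k)%N) `|q j - v j|.
  by rewrite -sumrN; apply: ler_sum => j _; rewrite -normrN ler_norm.
by move=> ? ? ? ?; rewrite -lerBlDl -sumrB; lra.
Qed.

(** * The lexicographically largest distribution of the ball *)

Section top_distribution.
Variables (m : nat) (v : 'I_m -> R) (eps : R).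
Hypotheses (v_prob : is_prob v) (eps_ge0 : 0 <= eps).

Let P k := \sum_(j < m | (j < k)%N) v j.

(** Cumulative function of the distribution that moves mass up to [eps / 2] from the last classes to
    the first. Index 0 is separate: the formula would give [min 1 (eps / 2)] there instead of 0. *)
Definition top_cdf (k : nat) : R :=
  if k == 0%N then 0 else Num.min 1 (P k + eps / 2).

Let P_le k l : (k <= l)%N -> P k <= P l.
Proof.
move=> kl; rewrite /P big_mkcond [leRHS]big_mkcond; apply: ler_sum => j _.
have [v0 _] := v_prob; case: ltnP => [jk|_]; first by rewrite (leq_trans jk).
by case: ifP.
Qed.

Let P_le1 k : P k <= 1.
Proof. by have [v0 <-] := v_prob; exact: psum_le_sum. Qed.

Let P0 : P 0 = 0. Proof. by rewrite /P big_pred0. Qed.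

Let m_gt0 : (0 < m)%N.
Proof.
case: m v v_prob => // v' [_]; rewrite big_ord0 => /esym/eqP.
by rewrite oner_eq0.
Qed.

Definition top_dist (j : 'I_m) : R := top_cdf j.+1 - top_cdf j.

Lemma psum_top_dist k : (k <= m)%N ->
  \sum_(j < m | (j < k)%N) top_dist j = top_cdf k.
Proof. by move=> km; rewrite telescope_psum// subr0. Qed.

Lemma in_ball_psum_le_top_cdf (q : 'I_m -> R) k : in_ball v eps q ->
  \sum_(j < m | (j < k)%N) q j <= top_cdf k.
Proof.
move=> qb; rewrite /top_cdf; case: eqP => [->|_]; first by rewrite big_pred0.
rewrite le_min in_ball_psum_le// andbT.
by case: qb => -[q0 <-] _; exact: psum_le_sum.
Qed.

Lemma in_ball_top_dist : in_ball v eps top_dist.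
Proof.
have Pm : P m = 1 by rewrite /P psum_full//; case: v_prob.
have [v0 v1] := v_prob.
split; first split.
- move=> j; rewrite subr_ge0 /top_cdf/=; case: eqP => _.
    by rewrite le_min ler01 addr_ge0 ?divr_ge0// sumr_ge0.
  by rewrite le_min !ge_min lexx /= lerD2r P_le ?orbT.
- rewrite -(psum_full _ (leqnn m)) psum_top_dist// /top_cdf gtn_eqF// Pm.
  by apply/min_idPl; rewrite lerDl divr_ge0.
(* The distance to [v] is the total variation of [G], which jumps once from 0 to at most [eps / 2]
   and then decreases back to 0. *)
pose G k := top_cdf k - P k.
have G0 : G 0%N = 0 by rewrite /G P0 subrr.
have GS k : G k.+1 = Num.min (1 - P k.+1) (eps / 2).
  by rewrite /G /top_cdf/= addr_minl addrAC subrr add0r.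
have Gm : G m = 0.
  rewrite -(prednK m_gt0) GS prednK// Pm subrr.
  by apply/min_idPl; rewrite divr_ge0.
have -> : \sum_j `|top_dist j - v j| = \sum_(0 <= j < m) `|G j.+1 - G j|.
  rewrite big_mkord; apply: eq_bigr => j _; congr `| _ |.
  by rewrite /top_dist /G /P psumS; lra.
rewrite big_ltn// G0 subr0 GS.
have -> : \sum_(1 <= j < m) `|G j.+1 - G j| = \sum_(1 <= j < m) - (G j.+1 - G j).
  apply: eq_big_nat => -[//|j] _; rewrite ler0_norm// subr_le0 !GS.
  by rewrite le_min !ge_min lexx orbT lerD2l lerN2 P_le.
rewrite sumrN telescope_sumr// Gm sub0r opprK GS ger0_norm.
  have : Num.min (1 - P 1) (eps / 2) <= eps / 2 by rewrite ge_min lexx orbT.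
  lra.
by rewrite le_min subr_ge0 P_le1 divr_ge0.
Qed.

(** At the first index where they differ, a larger entry of [u] would give a prefix sum above
    [top_cdf], the bound for the whole ball. *)
Lemma lex_max_top_dist (u : 'I_m -> R) : in_ball v eps u ->
  lex_ge u top_dist -> u = top_dist.
Proof.
move=> ub [//|[k [uk]]].
have := in_ball_psum_le_top_cdf k.+1 ub.
rewrite -psum_top_dist// !psumS (eq_bigr top_dist) ?lerD2l => [|j jk].
  by rewrite leNgt => /negbTE ->.
exact: uk.
Qed.

End top_distribution.

Lemma in_ball_perm m (v q : 'I_m -> R) (eps : R) (s : {perm 'I_m}) :
  in_ball v eps q -> in_ball (v \o s) eps (q \o s).
Proof.
move=> [[q0 q1] qv]; split; first split.
- by move=> j; exact: q0.
- by rewrite -q1 [RHS](reindex_inj (@perm_inj _ s)).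
- by apply: le_trans qv; rewrite [leRHS](reindex_inj (@perm_inj _ s)).
Qed.

(** Once the classes are relabelled by priority, the lexicographic maximizer is [top_dist], whose
    prefix sums attain the bounds for the ball all at once. *)
Lemma lex_maximizer_psum_ge m (v : 'I_m -> R) (eps : R) (s : {perm 'I_m})
    (p q : 'I_m -> R) (k : nat) :
  is_prob v -> 0 <= eps -> lex_maximizer (in_ball v eps) s p ->
  in_ball v eps q ->
  \sum_(j < m | (j < k)%N) q (s j) <= \sum_(j < m | (j < k)%N) p (s j).
Proof.
move=> vp e0 [pb pmax] qb.
have [km|/ltnW mk] := leqP k m; last first.
  rewrite !psum_full//; have [[_]] := in_ball_perm s pb.
  by have [[_]] := in_ball_perm s qb => /= -> _ ->.
have vsp : is_prob (v \o s).
  have : in_ball v 0 v by split=> //; rewrite big1// => j _; rewrite subrr normr0.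
  by move/(in_ball_perm s) => -[].
have pE : p \o s = top_dist (v \o s) eps.
  apply: (lex_max_top_dist vsp); first exact: in_ball_perm.
  (* Relabelled back by the inverse permutation, [top_dist] is a competitor in the original ball. *)
  have := in_ball_perm s^-1 (in_ball_top_dist vsp e0).
  have -> : (v \o s) \o (s^-1)%g = v by apply/funext => j /=; rewrite permKV.
  move/pmax; congr (lex_ge _ _).
  by apply/funext => j /=; rewrite permK.
under [leRHS]eq_bigr => j _ do rewrite -[p (s j)]/((p \o s) j) pE.
rewrite psum_top_dist//.
exact: (in_ball_psum_le_top_cdf vsp k (in_ball_perm s qb)).
Qed.

End partial_sums.

(** * Threshold policies *)

Section threshold_policy.
Context {R : realType}.

(** Rates are additive over classes, so a randomized action matters only through the marginal
    admission probability of each class. *)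
Lemma sum_set_marginal m (x : {set 'I_m} -> R) (g : 'I_m -> R) :
  \sum_(a : {set 'I_m}) x a * \sum_(i in a) g i =
  \sum_i (\sum_(a : {set 'I_m} | i \in a) x a) * g i.
Proof.
under eq_bigr do rewrite mulr_sumr big_mkcond/=.
rewrite exchange_big/=; apply: eq_bigr => i _.
by rewrite -big_mkcond/= mulr_suml.
Qed.

(** The inverse permutation sends a class to its priority rank. *)
Definition top_set m (s : {perm 'I_m}) (k : nat) : {set 'I_m} :=
  [set i | ((s^-1)%g i < k)%N].

Lemma sum_top_set m (s : {perm 'I_m}) (k : nat) (g : 'I_m -> R) :
  \sum_(i in top_set s k) g i = \sum_(j < m | (j < k)%N) g (s j).
Proof.
rewrite (reindex_inj (@perm_inj _ s)); apply: eq_bigl => j.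
by rewrite inE permK.
Qed.

Lemma psum_interpolation m (w : 'I_m -> R) (x : R) :
  0 <= x <= \sum_j w j -> exists (k : nat) (th : R), [/\ 0 <= th <= 1 &
    x = (1 - th) * \sum_(j < m | (j < k)%N) w j +
        th * \sum_(j < m | (j < k.+1)%N) w j].
Proof.
move=> /andP[x0 xw]; pose W k := \sum_(j < m | (j < k)%N) w j.
have W0 : W 0%N = 0 by rewrite /W big_pred0.
have ex : exists k, x <= W k by exists m; rewrite /W psum_full.
(* Minimality puts [x] strictly above the previous prefix sum, so the interpolation has a nonzero
   denominator; index 0 forces [x = 0]. *)
have [[|k] xk kmin] := ex_minnP ex.
  exists 0%N, 0; rewrite lexx ler01; split => //.
  rewrite mul0r addr0 subr0 mul1r -/(W 0%N) W0.
  by apply/eqP; rewrite eq_le x0 -W0 xk.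
have Wk : W k < x by rewrite ltNge; apply/negP => /kmin; rewrite ltnn.
have W1 : 0 < W k.+1 - W k by rewrite subr_gt0 (lt_le_trans Wk).
exists k, ((x - W k) / (W k.+1 - W k)); split.
  rewrite divr_ge0 ?subr_ge0 ?(ltW Wk) ?(ltW (lt_le_trans Wk xk))//=.
  by rewrite ler_pdivrMr// mul1r lerD2r.
rewrite -/(W k) -/(W k.+1); field; exact: lt0r_neq0.
Qed.

Lemma threshold_policy_improves m (s : {perm 'I_m}) (x : {set 'I_m} -> R)
    (g h r : 'I_m -> R) :
  (forall a, 0 <= x a) -> \sum_a x a = 1 ->
  (forall i, 0 <= g i) -> (forall i, 0 <= h i) ->
  (forall k l : 'I_m, (k <= l)%N -> r (s l) <= r (s k)) ->
  (forall k : nat, \sum_(j < m | (j < k)%N) g (s j)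
                   <= \sum_(j < m | (j < k)%N) h (s j)) ->
  exists x' : {set 'I_m} -> R, [/\ forall a, 0 <= x' a, \sum_a x' a = 1,
    \sum_a x' a * \sum_(i in a) h i = \sum_a x a * \sum_(i in a) g i &
    \sum_a x a * \sum_(i in a) g i * r i
      <= \sum_a x' a * \sum_(i in a) h i * r i].
Proof.
move=> x0 x1 g0 h0 rs gh.
pose xm i := \sum_(a : {set 'I_m} | i \in a) x a.
have xm0 i : 0 <= xm i by apply: sumr_ge0.
have xm1 i : xm i <= 1.
  by rewrite -x1 [leRHS](bigID (fun a : {set 'I_m} => i \in a))/= lerDl sumr_ge0.
pose y j := xm (s j) * g (s j).
have y0 j : 0 <= y j by rewrite mulr_ge0.
pose beta := \sum_j y j.
have betaE : \sum_a x a * \sum_(i in a) g i = beta.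
  by rewrite sum_set_marginal (reindex_inj (@perm_inj _ s)).
have yg k : \sum_(j < m | (j < k)%N) y j <= \sum_(j < m | (j < k)%N) h (s j).
  apply: le_trans (gh k); apply: ler_sum => j _.
  by rewrite ler_piMl.
(* The target rate is attainable: [beta] is at most the total of [h], by [yg] at [m]. *)
have [|k [th [/andP[th0 th1] bE]]] := @psum_interpolation m (h \o s) beta.
  by rewrite sumr_ge0//=; have := yg m; rewrite !psum_full.
(* As a sum of two indicators, [x'] stays a distribution even if the two sets coincide. *)
pose x' (a : {set 'I_m}) : R :=
  (1 - th) * (a == top_set s k)%:R + th * (a == top_set s k.+1)%:R.
have sumx' G : \sum_a x' a * G a =
    (1 - th) * G (top_set s k) + th * G (top_set s k.+1).
  under eq_bigr do rewrite mulrDl -!mulrA.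
  rewrite big_split/= -!mulr_sumr; congr (_ * _ + _ * _).
    rewrite (bigD1 (top_set s k))//= eqxx mul1r big1 ?addr0// => a /negbTE->.
    by rewrite mul0r.
  rewrite (bigD1 (top_set s k.+1))//= eqxx mul1r big1 ?addr0// => a /negbTE->.
  by rewrite mul0r.
exists x'; split.
- by move=> a; rewrite addr_ge0// mulr_ge0// subr_ge0.
- by under eq_bigr do rewrite -[x' _]mulr1; rewrite (sumx' (fun=> 1)); lra.
- by rewrite betaE (sumx' (fun a => \sum_(i in a) h i)) !sum_top_set -bE.
rewrite (sumx' (fun a => \sum_(i in a) h i * r i)) !sum_top_set.
rewrite (sum_set_marginal _ (fun i => g i * r i)) (reindex_inj (@perm_inj _ s))/=.
pose y' (j : 'I_m) := (1 - th) * (if (j < k)%N then h (s j) else 0) +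
             th * (if (j < k.+1)%N then h (s j) else 0).
have sumy' (P : pred 'I_m) G : \sum_(j < m | P j) y' j * G j =
    (1 - th) * \sum_(j < m | P j && (j < k)%N) h (s j) * G j +
    th * \sum_(j < m | P j && (j < k.+1)%N) h (s j) * G j.
  under eq_bigr do rewrite mulrDl -!mulrA.
  rewrite big_split/= -!mulr_sumr !big_mkcondr/=.
  by congr (_ * _ + _ * _); apply: eq_bigr => j _; case: ifP; rewrite ?mul0r.
have sumy'1 (P : pred 'I_m) : \sum_(j < m | P j) y' j =
    (1 - th) * \sum_(j < m | P j && (j < k)%N) h (s j) +
    th * \sum_(j < m | P j && (j < k.+1)%N) h (s j).
  under eq_bigr do rewrite -[y' _]mulr1.
  rewrite (sumy' P (fun=> 1)).
  by congr (_ * _ + _ * _); apply: eq_bigr => j _; rewrite mulr1.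
rewrite -(sumy' xpredT (fun j => r (s j))) -subr_ge0 -sumrB.
under eq_bigr do rewrite mulrA -mulrBl.
apply: sumr_mul_nonincreasing_ge0 => [//|l|]; last first.
  by rewrite sumrB -/beta sumy'1 -bE subrr.
rewrite sumrB subr_ge0 sumy'1.
have [lk|kl] := leqP l k.
  rewrite [X in (1 - th) * X](eq_bigl (fun j : 'I_m => (j < l)%N)) => [|j]; last by lia.
  rewrite [X in th * X](eq_bigl (fun j : 'I_m => (j < l)%N)) => [|j]; last by lia.
  by rewrite -mulrDl subrK mul1r; exact: yg.
rewrite [X in (1 - th) * X](eq_bigl (fun j : 'I_m => (j < k)%N)) => [|j]; last by lia.
rewrite [X in th * X](eq_bigl (fun j : 'I_m => (j < k.+1)%N)) => [|j]; last by lia.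
by rewrite -bE; exact: psum_le_sum.
Qed.

End threshold_policy.

(** * Admission control *)

Section admission_control.
Context {R : realType} {S m : nat}.
Variables (c : nat) (mu : R) (r : 'I_m -> 'I_S.+1 -> R).
Implicit Types (Lam : R) (p : 'I_S.+1 -> 'I_m -> R) (pi : policy R S m).
Hypotheses (c_gt0 : (1 <= c)%N) (mu_gt0 : 0 < mu).

Lemma death_ge0 (s : 'I_S.+1) : 0 <= death c mu s.
Proof. by rewrite mulr_ge0// ltW. Qed.

Lemma birth_ge0 Lam p pi (s : 'I_S.+1) : 0 <= Lam ->
  (forall s i, 0 <= p s i) -> is_policy pi -> 0 <= birth Lam p pi s.
Proof.
move=> L0 p0 pip; rewrite /birth; case: ifP => // _.
apply: sumr_ge0 => a _; have [pi0 _] := pip s; rewrite mulr_ge0//.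
by apply: sumr_ge0 => i _; rewrite mulr_ge0.
Qed.

(** The birth rate vanishes at [S] and the death rate at 0, so neither [H S.+1] nor the convention
    [0.-1 = 0] matters. *)
Lemma generator_mul Lam p pi (H : nat -> R) (i : 'I_S.+1) :
  \sum_j generator c mu Lam p pi i j * H j =
  birth Lam p pi i * (H i.+1 - H i) - death c mu i * (H i - H i.-1).
Proof.
set b := birth Lam p pi i; set d := death c mu i.
have bS : (i < S)%N || (b == 0).
  by rewrite /b /birth; case: ifP => //= _; rewrite eqxx.
have d0 : (0 < i)%N || (d == 0).
  by rewrite /d /death; case: (nat_of_ord i) => //=; rewrite min0n mul0r eqxx.
have E j : generator c mu Lam p pi i j * H j =
    (if (j : nat) == i.+1 then b * H i.+1 else 0) +
    (if j.+1 == i :> nat then d * H i.-1 else 0) +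
    (if j == i then - (b + d) * H i else 0).
  rewrite mxE -/b -/d -val_eqE [j == i]eq_sym -val_eqE /=.
  case: eqVneq => [->|ji1].
    rewrite !ifF ?addr0//; apply/negbTE; lia.
  case: eqVneq => [ji|ji].
    by rewrite -ji/= ifF ?add0r ?addr0//; apply/negbTE; lia.
  by case: eqVneq => [->|_]; rewrite ?mul0r !add0r.
under eq_bigr do rewrite E.
rewrite !big_split/= -!big_mkcond/= big_pred1_eq.
have -> : \sum_(j < S.+1 | (j : nat) == i.+1) b * H i.+1 = b * H i.+1.
  case/orP: bS => [iS|/eqP->]; last by rewrite mul0r big1// => j; rewrite mul0r.
  by rewrite (big_pred1 (Ordinal (iS : (i.+1 < S.+1)%N))).
have -> : \sum_(j < S.+1 | j.+1 == i) d * H i.-1 = d * H i.-1.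
  case/orP: d0 => [i0|/eqP->]; last by rewrite mul0r big1// => j; rewrite mul0r.
  have iS : (i.-1 < S.+1)%N by rewrite prednK// ltnW.
  rewrite (big_pred1 (Ordinal iS))// => j.
  by rewrite /= -[in LHS](prednK i0) eqSS.
ring.
Qed.

Lemma generator_row_sum Lam p pi (i : 'I_S.+1) :
  \sum_j generator c mu Lam p pi i j = 0.
Proof.
have := generator_mul Lam p pi (fun=> 1) i.
by rewrite !subrr !mulr0 subrr; under eq_bigr do rewrite mulr1.
Qed.

Lemma generator_offdiag_ge0 Lam p pi : 0 <= Lam ->
  (forall s i, 0 <= p s i) -> is_policy pi ->
  forall i j : 'I_S.+1, i != j -> 0 <= generator c mu Lam p pi i j.
Proof.
move=> L0 p0 pip i j ij; rewrite mxE; case: ifP => _; first exact: birth_ge0.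
case: ifP => _; first exact: death_ge0.
by rewrite (negbTE ij).
Qed.

Lemma transE Lam p pi t i j :
  trans c mu Lam p pi t i j = expmx (generator c mu Lam p pi) t i j.
Proof.
rewrite mxE /trans /pseries; congr (limn (series _)); apply/funext => k.
by rewrite exprZn mxE /expmx_coef -mulrA mulrC.
Qed.

Lemma poisson_generator Lam p pi (f : 'I_S.+1 -> R) : 0 <= Lam ->
  (forall s i, 0 <= p s i) -> is_policy pi ->
  exists rho h, poisson (generator c mu Lam p pi) f rho h.
Proof.
move=> L0 p0 pip.
(* [inord] extends the state functions to [nat]; the resulting equation is read only at states up to
   [S]. *)
have [|||rho [h rhoh]] := @birth_death_poisson R S
  (fun s => birth Lam p pi (inord s)) (fun s => (minn s c)%:R * mu) _ _ _
  (fun s => f (inord s)).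
- by move=> s; exact: birth_ge0.
- by move=> s /andP[s0 _]; rewrite mulr_gt0// ltr0n leq_min s0.
- by rewrite min0n mul0r.
exists rho, (fun s => h s) => s; rewrite generator_mul.
by have := rhoh s (ltn_ord s); rewrite inord_val.
Qed.

(** The proof shows actual convergence, so no default value of [lim] enters. *)
Lemma avg_rewardE Lam p pi rho h s0 : 0 <= Lam ->
  (forall s i, 0 <= p s i) -> is_policy pi ->
  poisson (generator c mu Lam p pi) (reward_rate r Lam p pi) rho h ->
  avg_reward c mu r Lam p pi s0 = rho.
Proof.
move=> L0 p0 pip P; rewrite /avg_reward; apply: cvg_lim => //.
rewrite (_ : exp_reward c mu r Lam p pi s0 = fun t =>
    \sum_j expmx (generator c mu Lam p pi) t s0 j * reward_rate r Lam p pi j).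
  apply: cesaro_expmx_poisson P.
  - exact: generator_offdiag_ge0.
  - exact: generator_row_sum.
apply/funext => t; rewrite /exp_reward.
by apply: eq_bigr => j _; rewrite transE.
Qed.

Lemma avg_reward_le Lam p pi Lam' p' pi' s0 : 0 <= Lam -> 0 <= Lam' ->
  (forall s i, 0 <= p s i) -> (forall s (i : 'I_m), 0 <= p' s i) ->
  is_policy pi -> is_policy pi' ->
  birth Lam p pi =1 birth Lam' p' pi' ->
  (forall s, reward_rate r Lam p pi s <= reward_rate r Lam' p' pi' s) ->
  avg_reward c mu r Lam p pi s0 <= avg_reward c mu r Lam' p' pi' s0.
Proof.
move=> L0 L0' p0 p0' pip pip' bb rr.
have [rho [h P]] := poisson_generator (reward_rate r Lam p pi) L0 p0 pip.
have [rho' [h' P']] := poisson_generator (reward_rate r Lam' p' pi') L0' p0' pip'.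
rewrite (avg_rewardE s0 L0 p0 pip P) (avg_rewardE s0 L0' p0' pip' P').
have EQ : generator c mu Lam p pi = generator c mu Lam' p' pi'.
  by apply/matrixP => i j; rewrite !mxE bb.
rewrite EQ in P; apply: poisson_le P P' rr.
- exact: generator_offdiag_ge0.
- exact: generator_row_sum.
Qed.

(** A [sup] is known to dominate its elements only when the set is bounded. The bound here is a
    constant reward dominating all reward rates, and [poisson_cst] gives its gain. *)
Lemma avg_reward_bounded Lam p s0 : 0 <= Lam ->
  (forall s i, 0 <= p s i) ->
  has_ubound [set avg_reward c mu r Lam p pi s0 | pi in @is_policy R S m].
Proof.
move=> L0 p0; exists (\sum_s \sum_i lam Lam p s i * `|r i s|) => _ [pi pip <-].
have [rho [h P]] := poisson_generator (reward_rate r Lam p pi) L0 p0 pip.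
rewrite (avg_rewardE s0 L0 p0 pip P).
apply: (poisson_le _ _ P (poisson_cst _ _)).
- exact: generator_offdiag_ge0.
- exact: generator_row_sum.
move=> s; rewrite (bigD1 s)//= ler_wpDr//.
  by do 2![apply: sumr_ge0 => ? _]; rewrite mulr_ge0// mulr_ge0.
rewrite /reward_rate; case: ifP => _; last first.
  by apply: sumr_ge0 => ? _; rewrite mulr_ge0// mulr_ge0.
have [pi0 pi1] := pip s; rewrite -[leRHS]mul1r -pi1 mulr_suml.
apply: ler_sum => a _; apply: ler_wpM2l => //.
rewrite [leRHS](bigID (mem a))/= ler_wpDr//.
  by apply: sumr_ge0 => ? _; rewrite mulr_ge0// mulr_ge0.
by apply: ler_sum => i _; rewrite ler_wpM2l ?mulr_ge0// ler_norm.
Qed.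

Lemma is_policy_admit_none :
  is_policy ((fun _ a => (a == finset.set0)%:R) : policy R S m).
Proof.
move=> s; split=> //; rewrite (bigD1 finset.set0)//= eqxx big1 ?addr0// => a.
by move/negbTE->.
Qed.

End admission_control.

Theorem theorem1 (R : realType) (S c m : nat) (mu : R) (r : 'I_m -> 'I_S.+1 -> R)
  (Lmin Lmax a b : R) (phat : 'I_m -> R) (eps : R)
  (sigma : 'I_S.+1 -> {perm 'I_m}) (ptil : 'I_S.+1 -> 'I_m -> R) :
  (1 <= c)%N -> 0 < mu ->
  0 < Lmin -> Lmin <= a -> a <= b -> b <= Lmax ->
  is_prob phat -> 0 <= eps ->
  (forall s, priority_order r s (sigma s)) ->
  (forall s, lex_maximizer (in_ball phat eps) (sigma s) (ptil s)) ->
  in_class a b phat eps b ptil /\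
  (forall Lam p, in_class a b phat eps Lam p ->
     forall s0 : 'I_S.+1,
       opt_reward c mu r Lam p s0 <= opt_reward c mu r b ptil s0).
Proof.
move=> c1 mu0 Lmin0 La ab _ phat_prob eps0 rsigma ptil_max.
have a0 : 0 < a by exact: lt_le_trans La.
have b0 : 0 <= b by exact/ltW/(lt_le_trans a0).
split; first by split=> [|s]; [rewrite ab lexx | case: (ptil_max s)].
move=> Lam p [/andP[aL Lb] pb] s0.
have L0 : 0 <= Lam by exact/ltW/(lt_le_trans a0).
have p0 s i : 0 <= p s i by case: (pb s) => -[].
have pt0 s i : 0 <= ptil s i by case: (ptil_max s) => -[[]].
(* The set under the [sup] must be nonempty: admitting nobody is a policy. *)
apply: ge_sup.
  exists (avg_reward c mu r Lam p (fun _ a => (a == finset.set0)%:R) s0).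
  by exists (fun _ a => (a == finset.set0)%:R) => //; exact: is_policy_admit_none.
move=> _ [pi pip <-].
(* The improvement is made in each state separately and assembled into one policy by choice. *)
have improve s : exists x' : {set 'I_m} -> R,
    [/\ forall a, 0 <= x' a, \sum_a x' a = 1,
    \sum_a x' a * \sum_(i in a) lam b ptil s i =
      \sum_a pi s a * \sum_(i in a) lam Lam p s i &
    \sum_a pi s a * \sum_(i in a) lam Lam p s i * r i s
      <= \sum_a x' a * \sum_(i in a) lam b ptil s i * r i s].
  have [pi0 pi1] := pip s.
  apply: (threshold_policy_improves (s := sigma s)) => //.
  - by move=> i; rewrite mulr_ge0.
  - by move=> i; rewrite mulr_ge0.
  - exact: rsigma.
  (* Both factors increase: [Lam] is at most [b], and prefix sums of [p s] are at most those of
     [ptil s]. *)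
  - move=> k; rewrite -!mulr_sumr ler_pM ?sumr_ge0//.
    exact: lex_maximizer_psum_ge (ptil_max s) (pb s).
have [pi' pi'P] := choice improve.
have pip' : is_policy pi' by move=> s; have [] := pi'P s.
apply: (@le_trans _ _ (avg_reward c mu r b ptil pi' s0)).
  apply: avg_reward_le => // s; have [_ _ bE rE] := pi'P s.
  - by rewrite /birth bE.
  - by rewrite /reward_rate; case: ifP.
apply: ub_le_sup; last by exists pi'.
exact: avg_reward_bounded.
Qed.
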